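(* Let $n\ge 3$, let $M\in\mathbb{R}^{n\times n}$ be a primitive doubly-stochastic matrix (nonnegative entries, $M\mathbf{1}=\mathbf{1}$, $M^\top\mathbf{1}=\mathbf{1}$, some power of $M$ entrywise positive), and let $\nu>0$. Let $\mathcal{P}_{\perp} = I_n - \frac1n \mathbf{1}\mathbf{1}^\top$ and $\mathcal{V}_{\perp} = \{x : \langle x,\mathbf{1}\rangle = 0\}$. Let $\mathbf{x}_{\perp},\mathbf{x}'_{\perp}\in\mathcal{V}_{\perp}$, set $\mathbf{s}=M\mathbf{x}_{\perp}$, $\mathbf{s}'=M\mathbf{x}'_{\perp}$, and let $\boldsymbol{\xi},\boldsymbol{\xi}'$ be independent random vectors with $\boldsymbol{\xi},\boldsymbol{\xi}'\sim\mathcal{N}(\mathbf{0},\frac{\nu^2}{n}I_n)$. Define the normalized outputs \[ \mathbf{u} = \frac{\mathcal{P}_{\perp}(\mathbf{s}+\boldsymbol{\xi})}{\|\mathcal{P}_{\perp}(\mathbf{s}+\boldsymbol{\xi})\|_2},\qquad \mathbf{v} = \frac{\mathcal{P}_{\perp}(\mathbf{s}'+\boldsymbol{\xi}')}{\|\mathcal{P}_{\perp}(\mathbf{s}'+\boldsymbol{\xi}')\|_2}, \] and the spectral signal-to-noise ratio \[ \gamma := \frac{\max(\|\mathbf{s}\|_2,\|\mathbf{s}'\|_2)}{\mathbb{E}\big[\|\mathcal{P}_{\perp}\boldsymbol{\xi}\|_2\big]}. \] Assume $\gamma\le 1/8$. Then for any $\epsilon>0$ and any failure tolerance $\delta\in(0,1)$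 there exist constants $C$ and $c>0$ such that, with probability at least $1-\delta-Ce^{-cn\epsilon^2}$, \[ |\langle \mathbf{u},\mathbf{v}\rangle| \le \epsilon + 8\gamma . \]
   Context: $\mathbf{1}$ is the all-ones vector in $\mathbb{R}^n$; $\|\cdot\|_2$ is the Euclidean norm and $\langle\cdot,\cdot\rangle$ the Euclidean inner product. The map $\mathbf{y}\mapsto \mathcal{P}_{\perp}\mathbf{y}/\|\mathcal{P}_{\perp}\mathbf{y}\|_2$ is (up to the factor $\sqrt n$) Layer Normalization without affine parameters. *)

(* Defs.v *)
From HB Require Import structures.
From mathcomp Require Import all_boot all_order all_algebra.
From mathcomp Require Import all_classical all_reals all_analysis.
Set Implicit Arguments. Unset Strict Implicit. Unset Printing Implicit Defensive.
Import Order.TTheory GRing.Theory Num.Theory.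
Local Open Scope classical_set_scope.
Local Open Scope ring_scope.

Section Defs.
Variable R : realType.

Definition dotv n (x y : 'cV[R]_n) : R := \sum_(i < n) x i 0 * y i 0.
Definition norm2 n (x : 'cV[R]_n) : R := Num.sqrt (dotv x x).

Definition ones n : 'cV[R]_n := const_mx 1.
Definition Pperp n : 'M[R]_n := 1%:M - (n%:R)^-1 *: (ones n *m (ones n)^T).

Definition in_Vperp n (x : 'cV[R]_n) : Prop := dotv x (ones n) = 0.

Definition doubly_stochastic n (M : 'M[R]_n) : Prop :=
  (forall i j, 0 <= M i j) /\ M *m ones n = ones n /\ M^T *m ones n = ones n.
Definition primitive_mx n (M : 'M[R]_n) : Prop :=
  exists k : nat, forall i j, 0 < (M ^+ k) i j.

Definition lnorm n (y : 'cV[R]_n) : 'cV[R]_n :=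
  (norm2 (Pperp n *m y))^-1 *: (Pperp n *m y).

Definition rvec d (T : measurableType d) n (X : 'I_n -> T -> R) (w : T)
  : 'cV[R]_n := \col_i X i w.

(* mutual independence of a finite family of real random variables:
   product rule for all families of Borel sets (subfamilies are obtained
   by taking B i = setT). *)
Definition mutually_independent d (T : measurableType d) (P : probability T R)
  (I : finType) (X : I -> T -> R) : Prop :=
  forall B : I -> set R, (forall i, measurable (B i)) ->
    P (\bigcap_(i in [set: I]) (X i @^-1` B i)) =
    (\prod_(i : I) P (X i @^-1` B i))%E.

(* X has law N(m, s^2) (s = standard deviation) *)
Definition has_normal_law d (T : measurableType d) (P : probability T R)
  (X : T -> R) (m s : R) : Prop :=
  measurable_fun setT X /\
  forall B : set R, measurable B -> P (X @^-1` B) = normal_prob m s B.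

Definition join_fam (T : Type) n (X Y : 'I_n -> T -> R) (k : 'I_n + 'I_n) : T -> R :=
  match k with inl i => X i | inr i => Y i end.

End Defs.

(* Main.v *)
Require Import Defs.
From HB Require Import structures.
From mathcomp Require Import all_boot all_order all_algebra.
From mathcomp Require Import all_classical all_reals all_analysis.
From mathcomp Require Import measurable_realfun ring lra.
Import Order.TTheory GRing.Theory Num.Theory.
Local Open Scope classical_set_scope.
Local Open Scope ring_scope.
Set Implicit Arguments.
Unset Strict Implicit.
Unset Printing Implicit Defensive.

(** The constants may depend on [eps] and [delta], so it suffices to bound the
failure probability by O(1/n): with [c = 1] and [C = exp(K eps^2)] the claimed
lower bound is nonpositive for [n < K]. Write a = s + P xi and b = s' + P xi'.
The inner products of xi and xi' with s and s', the product <xi,xi'>, the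
deviations |xi|^2 - nu^2 and |xi'|^2 - nu^2 and the means of the entries are sums
of uncorrelated terms, so Markov's inequality for one weighted sum of their
squares makes all of them small compared to nu^2. Then |a|^2 and |b|^2 are at
least nu^2 / 2, while <a,b> is <s,s'> up to (eps / 2) nu^2, and
|<s,s'>| <= (gamma E|P xi|)^2 <= gamma nu^2 / 8 since E|P xi| <= nu.

The required Gaussian moments (exact mean and variance, a bound on the fourth
moment) are read off from the exponential moments, which are integrals of other
normal densities. *)

(** * Integration against the image of a weighted measure *)

Section image_density.
Import HBNNSimple.

(** Monotone convergence along simple approximations of [f] reduces both sides to level sets, where
    the hypothesis on [nu] applies directly. It serves for normal densities, for laws of random
    variables ([G] constant), and for independence, where [G] is the product of the remaining
    factors. *)
Lemma ge0_integral_image_density d d' (T : measurableType d)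
    (U : measurableType d') (R : realType) (mu : {measure set T -> \bar R})
    (nu : {measure set U -> \bar R}) (X : T -> U) (G : T -> R) :
  measurable_fun setT X -> measurable_fun setT G -> (forall x, 0 <= G x) ->
  (forall B, measurable B -> nu B = (\int[mu]_(x in X @^-1` B) (G x)%:E)%E) ->
  forall f : U -> R, measurable_fun setT f -> (forall y, 0 <= f y) ->
  (\int[nu]_y (f y)%:E = \int[mu]_x (f (X x) * G x)%:E)%E.
Proof.
move=> mX mG G0 nuE f mf f0.
have mEf : measurable_fun setT (fun y => (f y)%:E) by exact/measurable_EFinP.
pose h := nnsfun_approx measurableT mEf.
have hcvg y : (h n y)%:E @[n --> \oo] --> (f y)%:E.
  by apply: (@cvg_nnsfun_approx _ _ _ _ measurableT _ mEf) => // z _; rewrite lee_fin.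
have hnd y : {homo (fun n => h n y) : a b / (a <= b)%N >-> a <= b}.
  by move=> a b ab; exact/lefP/nd_nnsfun_approx.
have mhX n : measurable_fun setT (h n \o X) by exact: measurableT_comp.
have -> : (\int[nu]_y (f y)%:E)%E = limn (fun n => \int[nu]_y (h n y)%:E)%E.
  rewrite -monotone_convergence//.
  - by apply: eq_integral => y _; apply/esym/cvg_lim.
  - by move=> n; exact/measurable_EFinP.
  - by move=> n y _; rewrite lee_fin.
  - by move=> y _ a b ab; rewrite lee_fin; exact: hnd.
have -> : (\int[mu]_x (f (X x) * G x)%:E)%E =
    limn (fun n => \int[mu]_x (h n (X x) * G x)%:E)%E.
  rewrite -monotone_convergence//.
  - apply: eq_integral => x _; apply/esym/cvg_lim => //.
    by apply: (cvgeZr (y := (G x)%:E) _ (hcvg (X x))).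
  - move=> n; apply/measurable_EFinP; apply: measurable_funM => //.
    exact: mhX.
  - by move=> n x _; rewrite lee_fin mulr_ge0.
  - by move=> y _ a b ab; rewrite lee_fin ler_wpM2r//; exact: hnd.
congr (limn _); apply/funext => n.
transitivity (\int[nu]_y
   (\sum_(r \in range (h n)) (r * \1_(h n @^-1` [set r]) y)%:E))%E.
  by apply: eq_integral => y _; rewrite /= fimfunE -fsumEFin.
have mB r : measurable (X @^-1` (h n @^-1` [set r])).
  by rewrite -[X in measurable X]setTI; exact: mX.
rewrite ge0_integral_fsum//; last 2 first.
- by move=> r; exact/measurable_EFinP/measurable_funM.
- by move=> r y _; exact: nnfun_muleindic_ge0.
transitivity (\int[mu]_x (\sum_(r \in range (h n))
    (r * \1_(h n @^-1` [set r]) (X x))%:E * (G x)%:E))%E; last first.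
  apply: eq_integral => x _.
  rewrite -ge0_mule_fsuml => [|y]; last exact: nnfun_muleindic_ge0.
  by rewrite fsumEFin// -(fimfunE _ (X x)).
have mi r : measurable_fun setT (fun x => \1_(h n @^-1` [set r]) (X x) : R).
  apply: (@measurableT_comp _ _ _ _ _ _ (\1_(h n @^-1` [set r]) : U -> R) _ X) => //.
rewrite ge0_integral_fsum//; last 2 first.
- move=> r; apply/measurable_EFinP; apply: measurable_funM => //.
  by apply: measurable_funM => //; exact: mi.
- move=> r x _; apply: mule_ge0; last by rewrite lee_fin.
  exact: nnfun_muleindic_ge0.
(* Writing [r] as a value of [h n] makes it nonnegative, as needed to take it out of the integral on
   the right. *)
apply: eq_fsbigr => r; rewrite inE => -[y _ <-].
under eq_integral do rewrite EFinM.
rewrite integralZl_indic_nnsfun//.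
under [RHS]eq_integral do rewrite EFinM -muleA.
rewrite ge0_integralZl//.
- rewrite integral_indic// setIT nuE//; congr (_ * _)%E.
  rewrite integral_mkcond; apply: eq_integral => x _.
  by rewrite epatch_indic muleC.
- by apply/measurable_EFinP; apply: measurable_funM => //; exact: mi.
- by move=> x _; rewrite mule_ge0 ?lee_fin.
- by rewrite lee_fin.
Qed.

End image_density.

(** * Means of integrable functions *)

(** Integrability and a finite value travel together, so that linear combinations of means carry no
    side conditions. *)
Definition has_mean d (T : measurableType d) (R : realType)
    (P : probability T R) (f : T -> R) (c : R) : Prop :=
  P.-integrable setT (fun w => (f w)%:E) /\ (\int[P]_w (f w)%:E = c%:E)%E.

Section has_mean_theory.
Context d (T : measurableType d) (R : realType) (P : probability T R).
Implicit Types (f g : T -> R) (a b c k : R).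

Lemma eq_has_mean f g a b : has_mean P f a -> f =1 g -> a = b -> has_mean P g b.
Proof. by move=> h /funext <- <-. Qed.

Lemma has_mean_measurable f a : has_mean P f a -> measurable_fun setT f.
Proof. by move=> [/integrableP[/measurable_EFinP]]. Qed.

Lemma ge0_has_mean f a : measurable_fun setT f -> (forall w, 0 <= f w) ->
  (\int[P]_w (f w)%:E = a%:E)%E -> has_mean P f a.
Proof.
move=> mf f0 fa; split=> //; apply/integrableP; split; first exact/measurable_EFinP.
under eq_integral do rewrite gee0_abs ?lee_fin//.
by rewrite fa ltry.
Qed.

Lemma has_mean_cst k : has_mean P (cst k) k.
Proof.
split; first exact: finite_measure_integrable_cst.
by have := integral_cst P measurableT k%:E; rewrite /= probability_setT mule1.
Qed.

Lemma has_meanD f g a b :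
  has_mean P f a -> has_mean P g b -> has_mean P (fun w => f w + g w) (a + b).
Proof.
move=> [fi fa] [gi gb]; split.
  by under eq_fun do rewrite EFinD; exact: integrableD.
by under eq_integral do rewrite EFinD; rewrite integralD// fa gb.
Qed.

Lemma has_meanZ k f a : has_mean P f a -> has_mean P (fun w => k * f w) (k * a).
Proof.
move=> [fi fa]; split.
  by under eq_fun do rewrite EFinM; exact: integrableZl.
by under eq_integral do rewrite EFinM; rewrite integralZl// fa.
Qed.

Lemma has_meanB f g a b :
  has_mean P f a -> has_mean P g b -> has_mean P (fun w => f w - g w) (a - b).
Proof.
move=> fa gb; apply: (eq_has_mean (has_meanD fa (has_meanZ (-1) gb))) => [w|];
  by rewrite mulN1r.
Qed.

Lemma has_mean_sum (I : finType) (f : I -> T -> R) (a : I -> R) :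
  (forall i, has_mean P (f i) (a i)) ->
  has_mean P (fun w => \sum_i f i w) (\sum_i a i).
Proof.
move=> fa; elim: (index_enum I) => [|i s ih].
  apply: (eq_has_mean (has_mean_cst 0)) => [w|]; by rewrite big_nil.
by apply: (eq_has_mean (has_meanD (fa i) ih)) => [w|]; rewrite big_cons.
Qed.

(** Gives existence only; the value is identified or bounded afterwards by comparison with known
    means. *)
Lemma has_mean_dominated f g b : measurable_fun setT f ->
  (forall w, `|f w| <= `|g w|) -> has_mean P g b -> exists a, has_mean P f a.
Proof.
move=> mf fg [gi _].
have fi : P.-integrable setT (fun w => (f w)%:E).
  apply: le_integrable gi => //; first exact/measurable_EFinP.
  by move=> w _; rewrite lee_fin.
exists (fine (\int[P]_w (f w)%:E)%E); split=> //.
by rewrite fineK//; exact: integrable_fin_num.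
Qed.

Lemma le_has_mean f g a b : has_mean P f a -> has_mean P g b ->
  (forall w, f w <= g w) -> a <= b.
Proof.
move=> [fi fa] [gi gb] fg; rewrite -lee_fin -fa -gb.
by apply: le_integral => // w _; rewrite lee_fin.
Qed.

Lemma has_mean_indic A : measurable A -> has_mean P (\1_A : T -> R) (fine (P A)).
Proof.
move=> mA; apply: ge0_has_mean => //.
by rewrite integral_indic// setIT fineK// fin_num_measure.
Qed.

Lemma has_mean_markov f a t : has_mean P f a -> (forall w, 0 <= f w) -> 0 < t ->
  (P [set w | (t <= f w)%R] <= (a / t)%:E)%E.
Proof.
move=> fa f0 t0; have mf := has_mean_measurable fa.
have mA : measurable [set w | t <= f w].
  rewrite -[X in measurable X]setTI.
  have -> : [set w | t <= f w] = f @^-1` `[t, +oo[.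
    by apply/seteqP; split=> w /=; rewrite in_itv/= andbT.
  exact: mf.
have i1 := has_mean_indic mA.
rewrite -[leLHS]fineK ?fin_num_measure// lee_fin ler_pdivlMr// mulrC.
apply: (le_has_mean (has_meanZ t i1) fa) => w.
rewrite indicE; have [|_] := boolP (w \in _); last by rewrite mulr0.
by rewrite inE/= mulr1.
Qed.

Lemma has_mean_unique f a b : has_mean P f a -> has_mean P f b -> a = b.
Proof. by move=> [_ +] [_ fb]; rewrite fb => -[]. Qed.

End has_mean_theory.

(** * Independence *)

Section independence.
Context d (T : measurableType d) (R : realType) (P : probability T R).
Variables (I : finType) (X : I -> T -> R).
Hypothesis mX : forall i, measurable_fun setT (X i).
Hypothesis indepX : mutually_independent P X.

Lemma measurable_prod_comp (A : {pred I}) (g : I -> R -> R) :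
  (forall i, measurable_fun setT (g i)) ->
  measurable_fun setT (fun w => \prod_(i in A) g i (X i w)).
Proof.
move=> mg; under eq_fun do rewrite big_mkcond/=.
apply: measurable_prod => i _; case: (i \in A) => //.
by apply: (measurableT_comp (mg i)).
Qed.

(** The product of indicators is the indicator of the intersection, so this is the definition of
    independence; it is the base case for general factors. *)
Lemma has_mean_indep_indic (B : I -> set R) (c : I -> R) :
  (forall i, measurable (B i)) ->
  (forall i, has_mean P (fun w => \1_(B i) (X i w)) (c i)) ->
  has_mean P (fun w => \prod_i \1_(B i) (X i w)) (\prod_i c i).
Proof.
move=> mB hc.
have mXB i : measurable (X i @^-1` B i).
  by rewrite -[X in measurable X]setTI; exact: mX.
have cE i : P (X i @^-1` B i) = (c i)%:E.
  have := has_mean_unique (hc i) (has_mean_indic P (mXB i)) => ->.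
  by rewrite fineK// fin_num_measure.
have mI : measurable (\bigcap_(i in [set: I]) (X i @^-1` B i)).
  by apply: fin_bigcap_measurable.
apply: (eq_has_mean (has_mean_indic P mI)).
- move=> w; rewrite indicE; have [/set_mem h|h] := boolP (w \in _).
    rewrite big1// => i _; rewrite indicE mem_set//; exact: h.
  have [i hi] : exists i, ~ B i (X i w).
    by apply/existsNP => hB; move/negP: h; apply; apply/mem_set => i _; exact: hB.
  by rewrite (bigD1 i)//= indicE memNset// mul0r.
- rewrite indepX// (eq_bigr (fun i => (c i)%:E)) ?prodEFin//.
Qed.

(* [g i] is arbitrary for [i] in [A] and an indicator elsewhere; [A] grows by one
   index at a time, by density of indicators in that coordinate. *)
Lemma ge0_has_mean_indep (A : {set I}) (g : I -> R -> R) (B : I -> set R)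
    (c : I -> R) :
  (forall i, measurable_fun setT (g i)) -> (forall i x, 0 <= g i x) ->
  (forall i, measurable (B i)) -> (forall i, i \notin A -> g i = \1_(B i)) ->
  (forall i, has_mean P (fun w => g i (X i w)) (c i)) ->
  has_mean P (fun w => \prod_i g i (X i w)) (\prod_i c i).
Proof.
have [n] := ubnP #|A|; elim: n A g B c => // n ih A g B c ltAn mg g0 mB gB hc.
have [A0|[a aA]] := set_0Vmem A.
  have gE i : g i = \1_(B i) by apply: gB; rewrite A0 inE.
  apply: (eq_has_mean (f := fun w => \prod_i \1_(B i) (X i w))) (erefl _).
    by apply: has_mean_indep_indic => // i; rewrite -gE.
  by move=> w; apply: eq_bigr => i _; rewrite gE.
pose G w := \prod_(i | i != a) g i (X i w).
pose q := \prod_(i | i != a) c i.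
have c0 i : 0 <= c i.
  by apply: (le_has_mean (has_mean_cst P 0) (hc i)) => w; exact: g0.
have q0 : 0 <= q by apply: prodr_ge0.
have G0 w : 0 <= G w by apply: prodr_ge0.
have mG : measurable_fun setT G by exact: measurable_prod_comp.
have mXa B0 : measurable B0 -> measurable (X a @^-1` B0).
  by move=> mB0; rewrite -[X in measurable X]setTI; exact: mX.
(* The induction hypothesis with the factor at [a] replaced by an indicator, which removes [a] from
   [A]. *)
have key (B0 : set R) : measurable B0 ->
    has_mean P (fun w => \1_B0 (X a w) * G w) (fine (P (X a @^-1` B0)) * q).
  move=> mB0.
  pose g' i := if i == a then \1_B0 else g i.
  pose c' i := if i == a then fine (P (X a @^-1` B0)) else c i.
  pose B' i := if i == a then B0 else B i.
  have := ih (A :\ a) g' B' c'.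
  rewrite (cardsD1 a A) aA add1n ltnS in ltAn => /(_ ltAn).
  have h1 i : measurable_fun setT (g' i).
    by rewrite /g'; case: eqP => // _; exact: measurable_indic.
  have h2 i x : 0 <= g' i x by rewrite /g'; case: eqP.
  have h3 i : measurable (B' i) by rewrite /B'; case: eqP.
  have h4 i : i \notin A :\ a -> g' i = \1_(B' i).
    rewrite !inE negb_and negbK /g' /B'; case: eqP => //= _; exact: gB.
  have h5 i : has_mean P (fun w => g' i (X i w)) (c' i).
    rewrite /g' /c'; case: eqP => [->|//]; exact: (has_mean_indic P (mXa _ mB0)).
  move=> /(_ h1 h2 h3 h4 h5) h.
  apply: (eq_has_mean h) => [w|]; rewrite (bigD1 a)//= /g' /c' eqxx;
    by congr (_ * _); apply: eq_bigr => i /negbTE ->.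
pose mixin := isMeasurableFun.Build _ _ _ _ (X a) (mX a).
pose Y : {mfun T >-> R} := HB.pack (X a) mixin.
(* By [key], the law of [X a] scaled by [q] is also the image under [X a] of [P] weighted by [G].
   Integrating [g a] against both descriptions gives the product formula. *)
have dens (B0 : set R) : measurable B0 -> mscale (NngNum q0) (distribution P Y) B0 =
    (\int[P]_(x in X a @^-1` B0) (G x)%:E)%E.
  move=> mB0; transitivity (\int[P]_w (\1_B0 (X a w) * G w)%:E)%E.
    rewrite (key _ mB0).2 mulrC EFinM fineK; first by [].
    by apply: fin_num_measure; exact: mXa.
  rewrite [RHS]integral_mkcond; apply: eq_integral => w _.
  by rewrite epatch_indic EFinM muleC.
have := ge0_integral_image_density (mX a) mG G0 dens (mg a) (g0 a).
rewrite ge0_integral_mscale//; [|exact/measurable_EFinP|by move=> *; rewrite lee_fin].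
rewrite ge0_integral_distribution; [|exact/measurable_EFinP|by move=> *; rewrite lee_fin].
rewrite /=.
have [_ ->] := hc a.
move=> hE; apply: ge0_has_mean.
- exact: measurable_prod_comp.
- by move=> w; apply: prodr_ge0.
- rewrite [in RHS](bigD1 a)//= mulrC EFinM hE.
  by apply: eq_integral => w _; rewrite (bigD1 a).
Qed.

(** [A] holds the indices whose factors may change sign. Splitting one such factor into positive and
    negative parts removes its index, until the nonnegative case is reached. *)
Lemma has_mean_indep_prod (A : {set I}) (g : I -> R -> R) (c : I -> R) :
  (forall i, measurable_fun setT (g i)) ->
  (forall i, i \notin A -> forall x, 0 <= g i x) ->
  (forall i, has_mean P (fun w => g i (X i w)) (c i)) ->
  has_mean P (fun w => \prod_i g i (X i w)) (\prod_i c i).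
Proof.
have [n] := ubnP #|A|; elim: n A g c => // n ih A g c ltAn mg g0 hc.
have [A0|[a aA]] := set_0Vmem A.
  (* With the full index set no factor has to be an indicator, so [set0] is a mere placeholder. *)
  apply: (@ge0_has_mean_indep [set: I]%SET g (fun=> set0)) => //.
    by move=> i x; apply: g0; rewrite A0 inE.
  by move=> i; rewrite inE.
pose pos (x : R) := Num.max (g a x) 0; pose neg (x : R) := Num.max (- g a x) 0.
have mpos : measurable_fun setT pos by exact: measurable_maxr.
have mneg : measurable_fun setT neg.
  by apply: measurable_maxr => //; exact: measurableT_comp.
have maxle (u : R) : `|Num.max u 0| <= `|u|.
  by have [u0|u0] := leP u 0; rewrite ?normr0.
have [p hp] : exists p, has_mean P (fun w => pos (X a w)) p.
  apply: (has_mean_dominated _ _ (hc a)); last by move=> w; exact: maxle.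
  exact: (measurableT_comp mpos).
have [m hm] : exists m, has_mean P (fun w => neg (X a w)) m.
  apply: (has_mean_dominated _ _ (hc a)); first exact: (measurableT_comp mneg).
  by move=> w; rewrite -[leRHS]normrN; exact: maxle.
have posneg x : g a x = pos x - neg x.
  rewrite /pos /neg; have [u0|u0] := leP (g a x) 0.
    by rewrite max_l ?oppr_ge0// sub0r opprK.
  by rewrite max_r ?oppr_le0 ?subr0// ltW.
have cE : c a = p - m.
  apply: (has_mean_unique (hc a)).
  by apply: (eq_has_mean (has_meanB hp hm)) => // w; rewrite posneg.
have ihr (h : R -> R) e : measurable_fun setT h -> (forall x, 0 <= h x) ->
    has_mean P (fun w => h (X a w)) e ->
    has_mean P (fun w => h (X a w) * \prod_(i | i != a) g i (X i w))
      (e * \prod_(i | i != a) c i).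
  move=> mh h0 he.
  pose g' i := if i == a then h else g i; pose c' i := if i == a then e else c i.
  have := ih (A :\ a) g' c'.
  rewrite (cardsD1 a A) aA add1n ltnS in ltAn => /(_ ltAn).
  have h1 i : measurable_fun setT (g' i) by rewrite /g'; case: eqP.
  have h2 i : i \notin A :\ a -> forall x, 0 <= g' i x.
    by rewrite !inE negb_and negbK /g'; case: eqP => //= _; exact: g0.
  have h3 i : has_mean P (fun w => g' i (X i w)) (c' i).
    by rewrite /g' /c'; case: eqP => [->|].
  move=> /(_ h1 h2 h3) H.
  apply: (eq_has_mean H) => [w|]; rewrite (bigD1 a)//= /g' /c' eqxx;
    by congr (_ * _); apply: eq_bigr => i /negbTE ->.
have pos0 x : 0 <= pos x by rewrite le_max lexx orbT.
have neg0 x : 0 <= neg x by rewrite le_max lexx orbT.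
apply: (eq_has_mean (has_meanB (ihr _ _ mpos pos0 hp) (ihr _ _ mneg neg0 hm))) => [w|].
  by rewrite -mulrBl -posneg [in RHS](bigD1 a).
by rewrite -mulrBl -cE [in RHS](bigD1 a).
Qed.

(** Subfamilies follow from the full family by putting the constant factor 1 at the indices outside
    [s]. *)
Lemma has_mean_indep (s : seq I) (f : I -> R -> R) (c : I -> R) : uniq s ->
  (forall i, i \in s -> measurable_fun setT (f i)) ->
  (forall i, i \in s -> has_mean P (fun w => f i (X i w)) (c i)) ->
  has_mean P (fun w => \prod_(i <- s) f i (X i w)) (\prod_(i <- s) c i).
Proof.
move=> us mf hc.
pose g i := if i \in s then f i else cst 1.
pose e i := if i \in s then c i else 1.
have h1 i : measurable_fun setT (g i).
  by rewrite /g; case: ifP => [/mf//|_]; exact: measurable_cst.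
have h2 i : has_mean P (fun w => g i (X i w)) (e i).
  by rewrite /g /e; case: ifP => [/hc//|_]; exact: has_mean_cst.
have h3 i : i \notin [set: I]%SET -> forall x, 0 <= g i x by rewrite inE.
apply: (eq_has_mean (has_mean_indep_prod h1 h3 h2)) => [w|].
  rewrite [RHS]big_uniq//= [RHS]big_mkcond; apply: eq_bigr => i _.
  by rewrite /g; case: ifP.
by rewrite [RHS]big_uniq//= [RHS]big_mkcond.
Qed.

End independence.

(** * Moments of the normal law *)

Section normal_moments.
Context d (T : measurableType d) (R : realType) (P : probability T R).
Variables (X : T -> R) (s : R).
Hypothesis s0 : 0 < s.
Hypothesis lawX : has_normal_law P X 0 s.

Let mX : measurable_fun setT X. Proof. by case: lawX. Qed.

(** Both sides are the integral of [f] against [normal_prob 0 s], seen once as the law of [X] and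
    once through its density. *)
Lemma ge0_integral_normal_law (f : R -> R) :
  measurable_fun setT f -> (forall x, 0 <= f x) ->
  (\int[P]_w (f (X w))%:E =
   \int[lebesgue_measure]_x (f x * normal_pdf 0 s x)%:E)%E.
Proof.
move=> mf f0; have [_ lawE] := lawX.
have := @ge0_integral_image_density _ _ _ _ R lebesgue_measure
  (normal_prob 0 s) id (normal_pdf 0 s) (@measurable_id _ _ setT)
  (measurable_normal_pdf 0 s) (normal_pdf_ge0 0 s) (fun B mB => erefl) f mf f0.
move=> /= <-; apply/esym.
have := @ge0_integral_image_density _ _ _ _ R P (normal_prob 0 s) X (cst 1)
  mX (measurable_cst _) (fun=> ler01) _ f mf f0.
move=> ->.
  by apply: eq_integral => w _; rewrite mulr1.
move=> B mB; have mXB : measurable (X @^-1` B).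
  by rewrite -[X in measurable X]setTI; exact: mX.
have := integral_cst P mXB 1%:E; rewrite /= => ->.
by rewrite mul1e lawE.
Qed.

(** Since a normal density has integral 1, a mean is known as soon as [f] turns the density of [X]
    into a multiple of another normal density. *)
Lemma has_mean_normal_tilt (f : R -> R) m t k : measurable_fun setT f ->
  (forall x, 0 <= f x) -> (forall x, f x * normal_pdf 0 s x = k * normal_pdf m t x) ->
  has_mean P (fun w => f (X w)) k.
Proof.
move=> mf f0 fk; apply: ge0_has_mean => //; first exact: (measurableT_comp mf).
rewrite ge0_integral_normal_law//.
under eq_integral do rewrite fk EFinM.
rewrite integralZl//; last exact: integrable_normal_pdf.
by rewrite integral_normal_pdf mule1.
Qed.

(** The coefficient of [X w ^+ 2] changes the standard deviation from [s] to [t]; the ratio of the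
    two peaks is [t / s]. *)
Lemma has_mean_expR_normal_sqr t : 0 < t ->
  has_mean P (fun w => expR ((s ^- 2 - t ^- 2) / 2 * X w ^+ 2)) (t / s).
Proof.
move=> t0; apply: (has_mean_normal_tilt (f := fun x => expR (_ * x ^+ 2)) (m := 0) (t := t)) => [|x|x].
- apply: measurableT_comp => //; apply: measurable_funM => //.
- exact: expR_ge0.
- rewrite !normal_pdfE ?gt_eqF// /normal_peak /normal_fun.
  have pk (r : R) : 0 < r -> Num.sqrt (r ^+ 2 * pi *+ 2) = r * Num.sqrt (pi *+ 2).
    by move=> r0; rewrite -mulrnAr sqrtrM ?sqr_ge0// sqrtr_sqr gtr0_norm.
  rewrite !pk// mulrCA -expRD [RHS]mulrA; congr (_ * expR _).
    by field; rewrite !gt_eqF//= sqrtr_gt0 mulrn_wgt0// pi_gt0.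
  by rewrite !subr0; field; rewrite !gt_eqF.
Qed.

(** Completing the square moves the centre of the density to [k * s ^+ 2]. *)
Lemma has_mean_expR_normal k :
  has_mean P (fun w => expR (k * X w)) (expR (k ^+ 2 * s ^+ 2 / 2)).
Proof.
apply: (has_mean_normal_tilt (f := fun x => expR (k * x)) (m := k * s ^+ 2) (t := s)) => [|x|x].
- by apply: measurableT_comp => //; apply: measurable_funM.
- exact: expR_ge0.
- rewrite !normal_pdfE ?gt_eqF// /normal_fun mulrCA -expRD [RHS]mulrCA -expRD.
  by congr (_ * expR _); field; rewrite !gt_eqF.
Qed.

(** Square the tangent bound [1 + y / 2 <= expR (y / 2)]. *)
Lemma sqr_le_expR (y : R) : 0 <= y -> y ^+ 2 <= 4 * expR y.
Proof.
move=> y0; have -> : expR y = expR (y / 2) ^+ 2.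
  by rewrite expr2 -expRD; congr expR; field.
have := expR_ge1Dx (y / 2); nra.
Qed.

(** This is 3/8 of [X w ^+ 2 / s ^+ 2], the exponent of the tilt from [s] to [2 * s]; its
    exponential has mean 2 and dominates the polynomial moments. *)
Let y w := (s ^- 2 - (2 * s) ^- 2) / 2 * X w ^+ 2.

Let yE w : X w ^+ 2 = 8 / 3 * s ^+ 2 * y w.
Proof. by rewrite /y; field; rewrite gt_eqF. Qed.

Let y_ge0 w : 0 <= y w.
Proof.
suff : 0 <= 8 / 3 * s ^+ 2 * y w by rewrite pmulr_rge0// mulr_gt0// exprn_gt0.
by rewrite -yE sqr_ge0.
Qed.

Let exp_y : has_mean P (fun w => expR (y w)) 2.
Proof.
have s20 : 0 < 2 * s by rewrite mulr_gt0.
apply: (eq_has_mean (has_mean_expR_normal_sqr s20)) => //.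
by field; rewrite gt_eqF.
Qed.

(* With [t = s (1 + h)], [expR u >= 1 + u] gives an inequality for the second
   moment at every [h > -1]; the value of [h] below forces equality. *)
Lemma has_mean_normal_sqr : has_mean P (fun w => X w ^+ 2) (s ^+ 2).
Proof.
have [q hq] : exists q, has_mean P (fun w => X w ^+ 2) q.
  apply: (has_mean_dominated _ _ (has_meanZ (8 / 3 * s ^+ 2) exp_y)) => [|w].
    exact: measurable_funX.
  rewrite ger0_norm ?sqr_ge0// (le_trans _ (ler_norm _))// yE.
  apply: ler_wpM2l; first by have := sqr_ge0 s; lra.
  by have := expR_ge1Dx (y w); lra.
have q0 : 0 <= q by apply: (le_has_mean (has_mean_cst P 0) hq) => w; rewrite sqr_ge0.
(* If e is the relative error of [q], the inequality at h reads h (2e - 3h + he - 2h^2) <= 0 once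
   denominators are cleared; e = 4h turns the left side into h^2 (5 + 2h). *)
pose h := (q / s ^+ 2 - 1) / 4.
have qE : q = s ^+ 2 * (1 + 4 * h) by rewrite /h; field; rewrite gt_eqF.
(* Nonnegativity of [q] keeps both [1 + h] and [5 + 2 * h] positive. *)
have h0 : - 4^-1 <= h.
  have : 0 <= q / s ^+ 2 by rewrite divr_ge0// sqr_ge0.
  rewrite /h; lra.
have h1 : 0 < 1 + h by lra.
have sh : 0 < s * (1 + h) by rewrite mulr_gt0.
have hle : 1 + (s ^- 2 - (s * (1 + h)) ^- 2) / 2 * q <= s * (1 + h) / s.
  apply: (le_has_mean (has_meanD (has_mean_cst P 1) (has_meanZ _ hq))
    (has_mean_expR_normal_sqr sh)) => w; exact: expR_ge1Dx.
have {}hle : 1 + (1 - (1 + h) ^- 2) / 2 * (1 + 4 * h) <= 1 + h.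
  move: hle; rewrite qE; congr (_ <= _); field.
    by rewrite !gt_eqF.
  by rewrite gt_eqF.
have {}hle : h * (2 + h) * (1 + 4 * h) <= 2 * h * (1 + h) ^+ 2.
  have hh : 0 < 2 * (1 + h) ^+ 2 by rewrite mulr_gt0// exprn_gt0.
  rewrite -(ler_pM2l hh) in hle.
  have e : 2 * (1 + h) ^+ 2 * (1 + (1 - (1 + h) ^- 2) / 2 * (1 + 4 * h)) =
    2 * (1 + h) ^+ 2 + h * (2 + h) * (1 + 4 * h) by field; rewrite gt_eqF.
  rewrite e in hle; lra.
have hz : h = 0.
  have : h ^+ 2 * (5 + 2 * h) <= 0 by nra.
  rewrite pmulr_lle0; last lra.
  by move=> h2; apply/eqP; rewrite -sqrf_eq0 eq_le h2 sqr_ge0.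
by move: hq; rewrite qE hz mulr0 addr0 mulr1.
Qed.

(** The fourth power is 64/9 s^4 y^2, with y^2 at most 4 exp(y) and exp(y) of mean 2; this gives
    512/9, rounded up to 57. *)
Lemma has_mean_normal_exp4 :
  exists2 k, k <= 57 * s ^+ 4 & has_mean P (fun w => X w ^+ 4) k.
Proof.
have dom w : X w ^+ 4 <= 256 / 9 * s ^+ 4 * expR (y w).
  have -> : X w ^+ 4 = 64 / 9 * s ^+ 4 * (y w) ^+ 2.
    by rewrite -[4%N]/(2 * 2)%N exprM yE; field.
  have := sqr_le_expR (y_ge0 w); rewrite -(ler_pM2l (_ : 0 < 64 / 9 * s ^+ 4)).
    by move=> /le_trans; apply; rewrite le_eqVlt; apply/orP; left; apply/eqP; field.
  by rewrite mulr_gt0// exprn_gt0.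
have [k hk] : exists k, has_mean P (fun w => X w ^+ 4) k.
  apply: (has_mean_dominated _ _ (has_meanZ (256 / 9 * s ^+ 4) exp_y)) => [|w].
    exact: measurable_funX.
  by rewrite ger0_norm ?exprn_even_ge0// (le_trans _ (ler_norm _)).
exists k => //; rewrite (le_trans (le_has_mean hk (has_meanZ _ exp_y) dom))//.
have : 0 <= s ^+ 4 by rewrite exprn_even_ge0.
lra.
Qed.

(* [1 + k a <= E exp(k X) = exp(k^2 s^2 / 2)] for small [k] of the sign of the
   mean [a] excludes [a != 0]. *)
Lemma has_mean_normal_id : has_mean P X 0.
Proof.
have [a ha] : exists a, has_mean P X a.
  apply: (has_mean_dominated _ _ (has_meanD (has_mean_cst P 1) has_mean_normal_sqr)) => // w.
  rewrite /= [leRHS]ger0_norm; last by rewrite addr_ge0// sqr_ge0.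
  rewrite ler_norml; apply/andP; split; nra.
suff -> : 0 = a by [].
apply/eqP/negPn/negP; rewrite eq_sym => a0.
pose b := s ^+ 2 / 2.
have b0 : 0 < b by rewrite divr_gt0// exprn_gt0.
have a2 : 0 < a ^+ 2 by rewrite exprn_even_gt0.
(* Multiply [1 + k * a <= expR (b * k ^+ 2)] by the tangent bound for the inverse exponential; the
   second alternative is the case where the signs forbid this. *)
have K k : (1 + k * a) * (1 - b * k ^+ 2) <= 1 \/ 1 - b * k ^+ 2 <= 0.
  have [?|le0] := leP (1 - b * k ^+ 2) 0; [by right|left].
  have h1 : 1 + k * a <= expR (b * k ^+ 2).
    have -> : b * k ^+ 2 = k ^+ 2 * s ^+ 2 / 2 by rewrite /b; field.
    apply: (le_has_mean (has_meanD (has_mean_cst P 1) (has_meanZ k ha))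
      (has_mean_expR_normal k)) => w; exact: expR_ge1Dx.
  have h2 : 1 - b * k ^+ 2 <= expR (- (b * k ^+ 2)) by exact: expR_ge1Dx.
  rewrite -[leRHS](expRxMexpNx_1 (b * k ^+ 2)).
  apply: (le_trans (ler_wpM2r (ltW le0) h1)).
  by rewrite ler_wpM2l ?expR_ge0.
(* For k = ta the product in [K] is 1 + t a^2 (1 - tb - t^2 b a^2). Taking t = 1/D makes tb + t b
   a^2 less than 1/2, so the bracket is positive and both alternatives fail. *)
pose D := 1 + 2 * b + 2 * b * a ^+ 2.
have ba : 0 < b * a ^+ 2 by rewrite mulr_gt0.
have D1 : 1 < D by rewrite /D; lra.
pose t := D^-1.
have tD : t * D = 1 by rewrite /t mulVf// gt_eqF//; lra.
have t0 : 0 < t by rewrite invr_gt0; lra.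
have t1 : t < 1 by rewrite /t invf_lt1//; lra.
have tb : t + 2 * (t * b) + 2 * (t * (b * a ^+ 2)) = 1.
  by rewrite -[RHS]tD /D; ring.
have tb0 : 0 < t * b by rewrite mulr_gt0.
have tba0 : 0 < t * (b * a ^+ 2) by rewrite mulr_gt0.
have ttba : t * (t * (b * a ^+ 2)) <= t * (b * a ^+ 2) by rewrite ler_piMl// ltW.
have := K (t * a).
have e1 : b * (t * a) ^+ 2 = t * (t * (b * a ^+ 2)) by ring.
rewrite e1 => -[]; last lra.
have -> : (1 + t * a * a) * (1 - t * (t * (b * a ^+ 2))) =
  1 + t * a ^+ 2 * (1 - t * b - t * (t * (b * a ^+ 2))) by ring.
apply/negP; rewrite -ltNge ltrDl; apply: mulr_gt0; [exact: mulr_gt0|lra].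
Qed.

End normal_moments.

(** * Second moments: orthogonal sums, and vanishing of nonnegative variables *)

Section orthogonal.
Context d (T : measurableType d) (R : realType) (P : probability T R).

Lemma has_mean_sqr_sum (J : finType) (Y : J -> T -> R) (v : J -> R) :
  (forall i, has_mean P (fun w => Y i w ^+ 2) (v i)) ->
  (forall i j, i != j -> has_mean P (fun w => Y i w * Y j w) 0) ->
  has_mean P (fun w => (\sum_i Y i w) ^+ 2) (\sum_i v i).
Proof.
move=> hv h0.
have h i j : has_mean P (fun w => Y i w * Y j w) (if j == i then v i else 0).
  by case: eqVneq => [->|ji]; [exact: hv|apply: h0; rewrite eq_sym].
apply: (eq_has_mean (has_mean_sum (fun i => has_mean_sum (h i)))) => [w|].
  by rewrite expr2 mulr_suml; apply: eq_bigr => i _; rewrite mulr_sumr.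
by apply: eq_bigr => i _; rewrite -big_mkcond big_pred1_eq.
Qed.

(** Such an [f] vanishes almost everywhere. This later excludes a zero denominator in the
    signal-to-noise ratio. *)
Lemma has_mean0_sqr (f : T -> R) b : (forall w, 0 <= f w) ->
  has_mean P f 0 -> has_mean P (fun w => f w ^+ 2) b -> b = 0.
Proof.
move=> f0 hf hb; have mf := has_mean_measurable hf.
have mEf : measurable_fun setT (fun w => (f w)%:E) by exact/measurable_EFinP.
have ae0 : ae_eq P setT (fun w => (f w)%:E) (cst 0%E).
  apply/(ae_eq_integral_abs _ measurableT mEf).
  by under eq_integral do rewrite gee0_abs ?lee_fin//; rewrite hf.2.
have : (\int[P]_w (f w ^+ 2)%:E = \int[P]_w (cst 0%E) w)%E.
  apply: ge0_ae_eq_integral => //.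
  - by apply/measurable_EFinP; exact: measurable_funX.
  - by move=> w _; rewrite lee_fin sqr_ge0.
  - apply: filterS ae0 => w /= h _; move: (h Logic.I) => -[->].
    by rewrite expr2 mulr0.
by rewrite integral0 hb.2 => -[].
Qed.

End orthogonal.

(** * Quadratic statistics of independent centred Gaussians *)

Section gaussian_family.
Context d (T : measurableType d) (R : realType) (P : probability T R).
Variables (I J : finType) (X : I -> T -> R) (sg : R).
Hypothesis sg0 : 0 < sg.
Hypothesis lawX : forall i, has_normal_law P (X i) 0 sg.
Hypothesis indepX : mutually_independent P X.

Let mX i : measurable_fun setT (X i). Proof. by case: (lawX i). Qed.

Lemma has_mean_indep2 (f : R -> R) i j a b : i != j -> measurable_fun setT f ->
  has_mean P (fun w => f (X i w)) a -> has_mean P (fun w => f (X j w)) b ->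
  has_mean P (fun w => f (X i w) * f (X j w)) (a * b).
Proof.
move=> ij mf ha hb.
have h k : k \in [:: i; j] ->
    has_mean P (fun w => f (X k w)) (if k == i then a else b).
  by rewrite !inE; case: eqP => [->//|_ /= /eqP ->].
have us : uniq [:: i; j] by rewrite /= inE ij.
apply: (eq_has_mean (has_mean_indep mX indepX us (fun k _ => mf) h)) => [w|].
  by rewrite big_cons big_seq1.
by rewrite big_cons big_seq1 eqxx eq_sym (negbTE ij).
Qed.

(** The injection [e] selects a subfamily, so that the noise vectors can be treated as halves of one
    joint family. Cross terms vanish because the means do. *)
Lemma has_mean_linear_sqr (e : J -> I) (s : J -> R) : injective e ->
  has_mean P (fun w => (\sum_j s j * X (e j) w) ^+ 2)
    (sg ^+ 2 * \sum_j s j ^+ 2).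
Proof.
move=> inje.
apply: (eq_has_mean (has_mean_sqr_sum (v := fun j => s j ^+ 2 * sg ^+ 2) _ _)) => //.
- move=> j; apply: (eq_has_mean (has_meanZ (s j ^+ 2) (has_mean_normal_sqr sg0 (lawX (e j))))) => // w.
  by rewrite exprMn.
- move=> i j ij.
  have eij : e i != e j by rewrite (inj_eq inje).
  have := has_mean_indep2 eij (@measurable_id _ _ setT)
    (has_mean_normal_id sg0 (lawX _)) (has_mean_normal_id sg0 (lawX _)).
  move=> /(has_meanZ (s i * s j)) h; apply: (eq_has_mean h) => [w|].
    by rewrite mulrACA.
  by rewrite !mulr0.
- by rewrite -mulr_suml mulrC.
Qed.

(** The centred squares are uncorrelated, and the variance of each is at most the fourth moment. *)
Lemma has_mean_square_deviation (e : J -> I) : injective e ->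
  exists2 k, k <= #|J|%:R * (57 * sg ^+ 4) &
  has_mean P (fun w => (\sum_j X (e j) w ^+ 2 - #|J|%:R * sg ^+ 2) ^+ 2) k.
Proof.
move=> inje.
(* Fourth moments are only bounded, not computed, so their values have to be chosen for all indices
   at once. *)
have /choice [v hv] : forall i : I, exists v, v <= 57 * sg ^+ 4 /\
    has_mean P (fun w => (X i w ^+ 2 - sg ^+ 2) ^+ 2) v.
  move=> i; have [k k57 hk] := has_mean_normal_exp4 sg0 (lawX i).
  have h2 := has_mean_normal_sqr sg0 (lawX i).
  exists (k - 2 * sg ^+ 2 * sg ^+ 2 + sg ^+ 4); split.
    have : 0 <= sg ^+ 4 by rewrite exprn_even_ge0.
    have -> : 2 * sg ^+ 2 * sg ^+ 2 = 2 * sg ^+ 4 by ring.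
    lra.
  apply: (eq_has_mean (has_meanD (has_meanB hk (has_meanZ (2 * sg ^+ 2) h2))
    (has_mean_cst P (sg ^+ 4)))) => // w /=; ring.
exists (\sum_j v (e j)).
  rewrite mulr_natl -sumr_const; apply: ler_sum => j _.
  by case: (hv (e j)).
have mf : measurable_fun setT (fun x : R => x ^+ 2 - sg ^+ 2).
  by apply: measurable_funB => //; exact: measurable_funX.
apply: (eq_has_mean (has_mean_sqr_sum (Y := fun j w => X (e j) w ^+ 2 - sg ^+ 2)
  (v := fun j => v (e j)) _ _)) => //.
- by move=> j; case: (hv (e j)).
- move=> i j ij; have eij : e i != e j by rewrite (inj_eq inje).
  have h i' : has_mean P (fun w => X i' w ^+ 2 - sg ^+ 2) 0.
    apply: (eq_has_mean (has_meanB (has_mean_normal_sqr sg0 (lawX i'))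
      (has_mean_cst P (sg ^+ 2)))) => //; by rewrite subrr.
  by apply: (eq_has_mean (has_mean_indep2 eij mf (h _) (h _))) => //; rewrite mulr0.
- by move=> w /=; rewrite sumrB sumr_const mulr_natl.
Qed.

(** Disjoint ranges make the four indices of a cross term distinct, so its mean is a product of
    zeros; a diagonal term is a product of two independent squares. *)
Lemma has_mean_bilinear_sqr (e e' : J -> I) : injective e -> injective e' ->
  (forall i j, e i != e' j) ->
  has_mean P (fun w => (\sum_j X (e j) w * X (e' j) w) ^+ 2)
    (#|J|%:R * sg ^+ 4).
Proof.
move=> inje inje' dis.
apply: (eq_has_mean (has_mean_sqr_sum (v := fun=> sg ^+ 4) _ _)) => //.
- move=> j.
  have mf : measurable_fun setT (fun x : R => x ^+ 2) by exact: measurable_funX.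
  apply: (eq_has_mean (has_mean_indep2 (dis j j) mf
    (has_mean_normal_sqr sg0 (lawX _)) (has_mean_normal_sqr sg0 (lawX _)))).
    by move=> w; rewrite exprMn.
  by rewrite -exprD.
- move=> i j ij.
  have us : uniq [:: e i; e' i; e j; e' j].
    by rewrite /= !inE !negb_or !(inj_eq inje, inj_eq inje', dis, ij) eq_sym dis.
  apply: (eq_has_mean (has_mean_indep mX indepX us
    (fun k _ => @measurable_id _ _ setT)
    (fun k _ => has_mean_normal_id sg0 (lawX k)))) => [w|].
    by rewrite !big_cons big_nil mulr1 !mulrA.
  by rewrite big_cons mul0r.
- by rewrite sumr_const mulr_natl.
Qed.

End gaussian_family.

(** * Normalized vectors *)

Section euclidean.
Variables (R : realType) (n : nat).
Implicit Types x y z : 'cV[R]_n.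

Lemma dotvC x y : dotv x y = dotv y x.
Proof. by apply: eq_bigr => i _; rewrite mulrC. Qed.

Lemma dotvDl x y z : dotv (x + y) z = dotv x z + dotv y z.
Proof. by rewrite -big_split; apply: eq_bigr => i _; rewrite mxE mulrDl. Qed.

Lemma dotvZl k x y : dotv (k *: x) y = k * dotv x y.
Proof. by rewrite mulr_sumr; apply: eq_bigr => i _; rewrite mxE mulrA. Qed.

Lemma dotvDr x y z : dotv x (y + z) = dotv x y + dotv x z.
Proof. by rewrite dotvC dotvDl !(dotvC x). Qed.

Lemma dotvZr k x y : dotv x (k *: y) = k * dotv x y.
Proof. by rewrite dotvC dotvZl (dotvC x). Qed.

Lemma dotv_ge0 x : 0 <= dotv x x.
Proof. by apply: sumr_ge0 => i _; rewrite -expr2 sqr_ge0. Qed.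

Lemma norm2_sqr x : norm2 x ^+ 2 = dotv x x.
Proof. by rewrite sqr_sqrtr// dotv_ge0. Qed.

Lemma norm2_ge0 x : 0 <= norm2 x. Proof. exact: sqrtr_ge0. Qed.

Lemma norm2_eq0 x : norm2 x = 0 -> x = 0.
Proof.
move=> x0; have : dotv x x = 0 by rewrite -norm2_sqr x0 expr0n.
move=> /eqP; rewrite psumr_eq0 => [/allP h|i _]; last by rewrite -expr2 sqr_ge0.
apply/colP => i; rewrite mxE; apply/eqP.
by have := h i (mem_index_enum i); rewrite /= -expr2 sqrf_eq0.
Qed.

Lemma dotv0l y : dotv 0 y = 0.
Proof. by rewrite /dotv big1// => i _; rewrite mxE mul0r. Qed.

(** Expand the squared norms of x + y and x - y. This suffices in place of Cauchy-Schwarz when both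
    norms share one bound. *)
Lemma normr_dotv_le x y : `|dotv x y| <= (dotv x x + dotv y y) / 2.
Proof.
have h1 := dotv_ge0 (x + y); have h2 := dotv_ge0 (x + (-1) *: y).
rewrite !dotvDl !dotvDr !dotvZl !dotvZr (dotvC y x) in h1 h2.
by rewrite ler_norml; apply/andP; split; lra.
Qed.

Lemma mulmx_Pperp x : Pperp R n *m x = x - (n%:R^-1 * dotv x (ones R n)) *: ones R n.
Proof.
rewrite mulmxBl mul1mx -scalemxAl -mulmxA; congr (_ - _).
rewrite -scalerA; congr (_ *: _); apply/colP => i.
rewrite !mxE big_ord1 !mxE mul1r mulr1; apply: eq_bigr => j _.
by rewrite !mxE mul1r mulr1.
Qed.

Lemma dotv_ones : dotv (ones R n) (ones R n) = n%:R.
Proof.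
rewrite /dotv (eq_bigr (fun=> 1)) => [|i _]; last by rewrite !mxE mulr1.
by rewrite sumr_const card_ord.
Qed.

(** Reduces projected inner products to raw ones and entry sums, whose moments are accessible. *)
Lemma dotv_Pperp x y : (0 < n)%N -> dotv (Pperp R n *m x) (Pperp R n *m y) =
  dotv x y - n%:R^-1 * dotv x (ones R n) * dotv y (ones R n).
Proof.
move=> n0; rewrite !mulmx_Pperp -!(scaleNr _ (ones R n)) !dotvDl !dotvDr !dotvZl !dotvZr dotv_ones.
rewrite (dotvC (ones R n) y); field.
by rewrite pnatr_eq0 -lt0n.
Qed.

(** Move [M] to the other side of the inner product: its transpose fixes [ones]. *)
Lemma doubly_stochastic_Vperp (M : 'M[R]_n) x :
  doubly_stochastic M -> in_Vperp x -> in_Vperp (M *m x).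
Proof.
move=> [_ [_ M1]] x0; rewrite /in_Vperp.
have dotE a b : dotv a b = (a^T *m b) 0 0.
  by rewrite mxE; apply: eq_bigr => i _; rewrite mxE.
by rewrite dotE trmx_mul -mulmxA M1 -dotE.
Qed.

(** Clears the denominators. If a projection is zero both sides hold, since the inverse of 0 is 0
    and the normalized vector is then 0. *)
Lemma lnorm_dotv_le x y k : 0 <= k ->
  `|dotv (lnorm x) (lnorm y)| <= k <->
  `|dotv (Pperp R n *m x) (Pperp R n *m y)| <=
    k * (norm2 (Pperp R n *m x) * norm2 (Pperp R n *m y)).
Proof.
rewrite /lnorm; set a := Pperp R n *m x; set b := Pperp R n *m y => k0.
rewrite dotvZl dotvZr.
have [/norm2_eq0 ->|a0] := eqVneq (norm2 a) 0.
  by rewrite dotv0l !mulr0 normr0 !mulr_ge0// norm2_ge0.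
have [/norm2_eq0 ->|b0] := eqVneq (norm2 b) 0.
  by rewrite (dotvC a) dotv0l !mulr0 normr0 !mulr_ge0// norm2_ge0.
have ab : 0 < norm2 a * norm2 b by rewrite mulr_gt0// lt0r ?a0 ?b0 norm2_ge0.
have -> : (norm2 a)^-1 * ((norm2 b)^-1 * dotv a b) = dotv a b / (norm2 a * norm2 b).
  by field; rewrite a0 b0.
by rewrite normrM (gtr0_norm (x := _^-1)) ?invr_gt0// ler_pdivrMr.
Qed.

End euclidean.

(* [ss], [ss'], [st] are the inner products of s and s'; [sx], [sx'], [tx], [tx']
   those of s, resp. s', with xi and xi'; [xx] is <xi,xi'>, [S] and [S'] are |xi|^2
   and |xi'|^2, and [L], [L'] are the sums of the entries of xi and xi'. *)
Lemma normalized_overlap_bound (R : realType) (n0 nu tau eps g m ss ss' st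
    sx sx' tx tx' xx S S' L L' : R) :
  0 < n0 -> 0 < nu -> 0 < eps -> 0 <= g <= 8^-1 -> 0 <= m <= nu ->
  0 <= tau <= 8^-1 -> 8 * tau <= eps ->
  0 <= ss -> 0 <= ss' -> `|st| <= (g * m) ^+ 2 ->
  `|sx| <= tau * nu ^+ 2 -> `|sx'| <= tau * nu ^+ 2 ->
  `|tx| <= tau * nu ^+ 2 -> `|tx'| <= tau * nu ^+ 2 ->
  `|xx| <= tau * nu ^+ 2 ->
  `|S - nu ^+ 2| <= tau * nu ^+ 2 -> `|S' - nu ^+ 2| <= tau * nu ^+ 2 ->
  n0^-1 * L ^+ 2 <= tau * nu ^+ 2 -> n0^-1 * L' ^+ 2 <= tau * nu ^+ 2 ->
  `|st + sx' + tx + xx - n0^-1 * L * L'| <=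
  (eps + 8 * g) * (Num.sqrt (ss + 2 * sx + S - n0^-1 * L * L) *
                   Num.sqrt (ss' + 2 * tx' + S' - n0^-1 * L' * L')).
Proof.
move=> n00 nu0 e0 /andP[g0 g8] /andP[m0 mnu] /andP[t0 t8] te ss0 ss0' hst.
rewrite !(ler_norml _ (tau * _)) => /andP[? ?] /andP[? ?] /andP[? ?] /andP[? ?]
  /andP[? ?] /andP[? ?] /andP[? ?].
rewrite !expr2 !mulrA => ? ?.
have nu2 : 0 < nu * nu by rewrite mulr_gt0.
have tnu : tau * nu * nu <= 8^-1 * (nu * nu) by rewrite -mulrA ler_wpM2r// ltW.
set A := ss + _ + _ - _; set B := ss' + _ + _ - _.
(* The errors are 2 [tau] from the cross term, [tau] from [S] and [tau] from the mean, in units of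
   nu^2; together at most 1/2. *)
have A2 : nu * nu / 2 <= A by rewrite /A; lra.
have B2 : nu * nu / 2 <= B by rewrite /B; lra.
have AB : nu * nu / 2 <= Num.sqrt A * Num.sqrt B.
  have h0 : 0 <= nu * nu / 2 by lra.
  have -> : nu * nu / 2 = Num.sqrt (nu * nu / 2) * Num.sqrt (nu * nu / 2).
    by rewrite -[RHS]expr2 sqr_sqrtr.
  by apply: ler_pM; rewrite ?sqrtr_ge0// ler_wsqrtr.
(* Arithmetic-geometric mean inequality, through the squares of [L - L'] and [L + L']. *)
have LL : `|n0^-1 * L * L'| <= tau * nu * nu.
  have i0 : 0 < n0^-1 by rewrite invr_gt0.
  have h1 : 0 <= n0^-1 * (L - L') ^+ 2 by rewrite mulr_ge0 ?sqr_ge0// ltW.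
  have h2 : 0 <= n0^-1 * (L + L') ^+ 2 by rewrite mulr_ge0 ?sqr_ge0// ltW.
  rewrite ler_norml; apply/andP; split; lra.
have gm : (g * m) ^+ 2 <= g * (nu * nu) / 8.
  have mm : m * m <= nu * nu by apply: ler_pM.
  have gg : g * g <= g / 8 by rewrite ler_wpM2l.
  have -> : (g * m) ^+ 2 = g * g * (m * m) by ring.
  have -> : g * (nu * nu) / 8 = g / 8 * (nu * nu) by ring.
  by apply: ler_pM => //; rewrite mulr_ge0.
(* The numerator has four noise terms: two signal-noise products, the noise-noise product and the
   product of the means. *)
have tn : 4 * (tau * nu * nu) <= eps * (nu * nu / 2).
  have -> : 4 * (tau * nu * nu) = 8 * tau * (nu * nu / 2) by field.
  by rewrite ler_wpM2r//; lra.
have gn : 0 <= g * (nu * nu) by rewrite mulr_ge0// ltW.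
have : (eps + 8 * g) * (nu * nu / 2) <= (eps + 8 * g) * (Num.sqrt A * Num.sqrt B).
  by rewrite ler_wpM2l//; lra.
rewrite -(mulrA (eps + 8 * g)) => /(le_trans _); apply.
move: hst LL; rewrite !ler_norml => /andP[? ?] /andP[? ?].
rewrite mulrDl; have -> : 8 * g * (nu * nu / 2) = 4 * (g * (nu * nu)) by field.
apply/andP; split; lra.
Qed.

(** * Moments of one noise vector and of its projection *)

Section noise.
Context d (T : measurableType d) (R : realType) (P : probability T R).
Variables (I : finType) (X : I -> T -> R) (n : nat) (nu : R) (e : 'I_n -> I).
Hypothesis n1 : (1 < n)%N.
Hypothesis nu0 : 0 < nu.
Let sg := nu / Num.sqrt n%:R.
Hypothesis lawX : forall i, has_normal_law P (X i) 0 sg.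
Hypothesis indepX : mutually_independent P X.
Hypothesis inje : injective e.

Let xi := rvec (fun i => X (e i)).

Let n0 : 0 < n%:R :> R. Proof. by rewrite ltr0n ltnW. Qed.

Lemma noise_sd_gt0 : 0 < sg.
Proof. by rewrite divr_gt0// sqrtr_gt0. Qed.

Lemma noise_sd_sqr : sg ^+ 2 = nu ^+ 2 / n%:R.
Proof. by rewrite expr_div_n sqr_sqrtr// ltW. Qed.

Lemma has_mean_dotv_noise_sqr (s : 'cV[R]_n) :
  has_mean P (fun w => dotv s (xi w) ^+ 2) (nu ^+ 2 / n%:R * dotv s s).
Proof.
apply: (eq_has_mean (has_mean_linear_sqr noise_sd_gt0 lawX indepX
  (fun i => s i 0) inje)) => [w|].
  by congr (_ ^+ 2); apply: eq_bigr => i _; rewrite mxE.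
by rewrite noise_sd_sqr; congr (_ * _); apply: eq_bigr => i _; rewrite expr2.
Qed.

Lemma has_mean_noise_sum_sqr :
  has_mean P (fun w => dotv (xi w) (ones R n) ^+ 2) (nu ^+ 2).
Proof.
apply: (eq_has_mean (has_mean_dotv_noise_sqr (ones R n))) => [w|].
  by rewrite dotvC.
by rewrite dotv_ones divfK ?gt_eqF.
Qed.

Lemma has_mean_noise_norm_deviation :
  exists2 k, k <= 57 * nu ^+ 4 / n%:R &
  has_mean P (fun w => (dotv (xi w) (xi w) - nu ^+ 2) ^+ 2) k.
Proof.
have [k k57 hk] := has_mean_square_deviation noise_sd_gt0 lawX indepX inje.
exists k.
  apply: (le_trans k57); rewrite card_ord -[4%N]/(2 * 2)%N !exprM noise_sd_sqr.
  rewrite le_eqVlt; apply/orP; left; apply/eqP; field; exact: lt0r_neq0.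
apply: (eq_has_mean hk) => // w; congr ((_ - _) ^+ 2).
  by apply: eq_bigr => i _; rewrite mxE expr2.
by rewrite card_ord noise_sd_sqr; field; exact: lt0r_neq0.
Qed.

Lemma has_mean_Pperp_noise_sqr :
  has_mean P (fun w => norm2 (Pperp R n *m xi w) ^+ 2)
    (nu ^+ 2 - nu ^+ 2 / n%:R).
Proof.
have hS : has_mean P (fun w => dotv (xi w) (xi w)) (nu ^+ 2).
  apply: (eq_has_mean (has_mean_sum
    (fun i => has_mean_normal_sqr noise_sd_gt0 (lawX (e i))))) => [w|].
    by apply: eq_bigr => i _; rewrite mxE expr2.
  rewrite sumr_const card_ord noise_sd_sqr -mulr_natl.
  by field; exact: lt0r_neq0.
apply: (eq_has_mean (has_meanB hS (has_meanZ n%:R^-1 has_mean_noise_sum_sqr))).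
  by move=> w; rewrite norm2_sqr dotv_Pperp 1?ltnW// expr2 mulrA.
by rewrite [in RHS]mulrC.
Qed.

(** Here [m] is the denominator of the signal-to-noise ratio: positivity turns the ratio back into
    signal norms, and [m <= nu] compares these with the noise level. *)
Lemma has_mean_Pperp_noise : exists2 m, 0 < m <= nu &
  has_mean P (fun w => norm2 (Pperp R n *m xi w)) m.
Proof.
have hN := has_mean_Pperp_noise_sqr.
(* A bound linear in the squared norm gives both integrability and, on taking means, [m <= nu]. *)
have le w : norm2 (Pperp R n *m xi w) <=
    (2 * nu)^-1 * norm2 (Pperp R n *m xi w) ^+ 2 + nu / 2.
  set r := norm2 _.
  have -> : (2 * nu)^-1 * r ^+ 2 + nu / 2 = r + (2 * nu)^-1 * (r - nu) ^+ 2.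
    by field; exact: lt0r_neq0.
  by rewrite lerDl mulr_ge0 ?sqr_ge0// invr_ge0 mulr_ge0// ltW.
have hD := has_meanD (has_meanZ (2 * nu)^-1 hN) (has_mean_cst P (nu / 2)).
have [m hm] : exists m, has_mean P (fun w => norm2 (Pperp R n *m xi w)) m.
  apply: (has_mean_dominated _ _ hD) => [|w]; last first.
    by rewrite ger0_norm ?norm2_ge0// (le_trans (le w)) ?ler_norm.
  rewrite (_ : (fun w => _) = fun w =>
    Num.sqrt (norm2 (Pperp R n *m xi w) ^+ 2)); last first.
    by apply/funext => w; rewrite sqrtr_sqr ger0_norm ?norm2_ge0.
  apply: (@measurableT_comp _ _ _ _ _ _ (@Num.sqrt R)).
    by apply: continuous_measurable_fun; exact: sqrt_continuous.
  exact: has_mean_measurable hN.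
exists m => //; apply/andP; split; last first.
  apply: (le_trans (le_has_mean hm hD le)).
  have -> : (2 * nu)^-1 * (nu ^+ 2 - nu ^+ 2 / n%:R) + nu / 2 =
      nu - nu / (2 * n%:R) by field; rewrite !lt0r_neq0.
  by rewrite gerBl divr_ge0 ?mulr_ge0 ?ltW.
have m0 : 0 <= m.
  by apply: (le_has_mean (has_mean_cst P 0) hm) => w; exact: norm2_ge0.
(* A zero mean would force the second moment nu^2 (1 - 1/n) to vanish, which [1 < n] forbids. *)
rewrite lt0r m0 andbT; apply/eqP => mz; rewrite mz in hm.
have := has_mean0_sqr (fun w => norm2_ge0 _) hm hN.
have -> : nu ^+ 2 - nu ^+ 2 / n%:R = nu ^+ 2 * (n%:R - 1) / n%:R.
  by field; exact: lt0r_neq0.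
apply/eqP; rewrite !mulf_neq0 ?invr_neq0// ?expf_neq0 ?lt0r_neq0//.
by rewrite subr_gt0 ltr1n.
Qed.

End noise.

(** * From noise moments to the probability of a small overlap *)

Lemma probability_ge_setC d (T : measurableType d) (R : realType)
    (P : probability T R) (A B : set T) (p : R) :
  measurable A -> measurable B -> ~` B `<=` A -> (P B <= p%:E)%E ->
  ((1 - p)%:E <= P A)%E.
Proof.
move=> mA mB BA Bp.
apply: (@le_trans _ _ (P (~` B))).
  by rewrite probability_setC// EFinB leeB.
by apply: le_measure; rewrite ?inE//; exact: measurableC.
Qed.

Lemma normr_le_of_sqr_div_lt (R : realType) (x k t : R) : 0 < k -> 0 <= t ->
  x ^+ 2 / k ^+ 2 < t ^+ 2 -> `|x| <= t * k.
Proof.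
move=> k0 t0; rewrite ltr_pdivrMr ?exprn_gt0// -exprMn => h.
have tk : 0 <= t * k by rewrite mulr_ge0// ltW.
by rewrite -(ler_pXn2r (n := 2)) ?nnegrE// real_normK ?num_real// ltW.
Qed.

Section overlap.
Context d (T : measurableType d) (R : realType) (P : probability T R).
Variables (n : nat) (nu : R) (xi xi' : 'I_n -> T -> R) (s s' : 'cV[R]_n).
Hypothesis n1 : (1 < n)%N.
Hypothesis nu0 : 0 < nu.
Hypothesis lawxi : forall i, has_normal_law P (xi i) 0 (nu / Num.sqrt n%:R).
Hypothesis lawxi' : forall i, has_normal_law P (xi' i) 0 (nu / Num.sqrt n%:R).
Hypothesis indep : mutually_independent P (join_fam xi xi').
Hypotheses (s0 : in_Vperp s) (s0' : in_Vperp s').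

Let lawX k : has_normal_law P (join_fam xi xi' k) 0 (nu / Num.sqrt n%:R).
Proof. by case: k. Qed.

Let n0 : 0 < n%:R :> R. Proof. by rewrite ltr0n ltnW. Qed.
Let inl_inj : injective (@inl 'I_n 'I_n). Proof. by move=> i j []. Qed.
Let inr_inj : injective (@inr 'I_n 'I_n). Proof. by move=> i j []. Qed.

Let x := rvec xi.
Let x' := rvec xi'.
Let L w := dotv (x w) (ones R n).
Let L' w := dotv (x' w) (ones R n).

(* Normalized so that every summand has mean O(1/n). *)
Definition noise_defect w : R :=
  (dotv s (x w) ^+ 2 + dotv s (x' w) ^+ 2 + dotv s' (x w) ^+ 2 +
   dotv s' (x' w) ^+ 2 + dotv (x w) (x' w) ^+ 2 +
   (dotv (x w) (x w) - nu ^+ 2) ^+ 2 + (dotv (x' w) (x' w) - nu ^+ 2) ^+ 2)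
    / (nu ^+ 2) ^+ 2 +
  (L w ^+ 2 + L' w ^+ 2) / (n%:R * nu ^+ 2).

(** In units of 1/n, the four signal-noise terms and the noise-noise term contribute at most 1 each,
    the two norm deviations 57 each and the entry sums 2 together: 121. *)
Lemma has_mean_noise_defect :
  dotv s s <= nu ^+ 2 -> dotv s' s' <= nu ^+ 2 ->
  exists2 k, k <= 121 / n%:R & has_mean P noise_defect k.
Proof.
move=> ss ss'.
have lin t := has_mean_dotv_noise_sqr n1 nu0 lawX indep inl_inj t.
have lin' t := has_mean_dotv_noise_sqr n1 nu0 lawX indep inr_inj t.
have sum := has_mean_noise_sum_sqr n1 nu0 lawX indep inl_inj.
have sum' := has_mean_noise_sum_sqr n1 nu0 lawX indep inr_inj.
have [k k57 dev] := has_mean_noise_norm_deviation n1 nu0 lawX indep inl_inj.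
have [k' k57' dev'] := has_mean_noise_norm_deviation n1 nu0 lawX indep inr_inj.
have dis (i j : 'I_n) : inl i != inr j :> 'I_n + 'I_n by [].
have cross : has_mean P (fun w => dotv (x w) (x' w) ^+ 2) (nu ^+ 4 / n%:R).
  apply: (eq_has_mean (has_mean_bilinear_sqr (noise_sd_gt0 n1 nu0) lawX indep
    inl_inj inr_inj dis)) => [w|].
    by congr (_ ^+ 2); apply: eq_bigr => i _; rewrite !mxE.
  rewrite card_ord -[4%N]/(2 * 2)%N !exprM noise_sd_sqr//.
  by field; exact: lt0r_neq0.
have h := has_meanD
  (has_meanZ ((nu ^+ 2) ^+ 2)^-1 (has_meanD (has_meanD (has_meanD (has_meanD
    (has_meanD (has_meanD (lin s) (lin' s)) (lin s')) (lin' s')) cross) dev) dev'))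
  (has_meanZ (n%:R * nu ^+ 2)^-1 (has_meanD sum sum')).
eexists; last first.
  by apply: (eq_has_mean h) => // w; rewrite /noise_defect !(mulrC _ _^-1).
have nu2 : 0 < nu ^+ 2 by rewrite exprn_gt0.
have nn : 0 <= nu ^+ 2 / n%:R by rewrite divr_ge0 ?ltW.
have l1 := ler_wpM2l nn ss; have l2 := ler_wpM2l nn ss'.
rewrite -[leRHS](mulrK (x := (nu ^+ 2) ^+ 2)); last by rewrite unitfE !expf_neq0 ?lt0r_neq0.
have -> : (n%:R * nu ^+ 2)^-1 * (nu ^+ 2 + nu ^+ 2) =
    ((nu ^+ 2) ^+ 2)^-1 * (2 * (nu ^+ 4 / n%:R)) by field; rewrite !lt0r_neq0.
rewrite -mulrDr [leRHS]mulrC ler_pM2l ?invr_gt0 ?exprn_gt0//.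
have e1 : nu ^+ 2 / n%:R * nu ^+ 2 = nu ^+ 4 / n%:R by ring.
have e2 : 57 * nu ^+ 4 / n%:R = 57 * (nu ^+ 4 / n%:R) by ring.
have e3 : 121 / n%:R * (nu ^+ 2) ^+ 2 = 121 * (nu ^+ 4 / n%:R) by ring.
rewrite e3; rewrite e1 in l1 l2; rewrite e2 in k57 k57'; lra.
Qed.

(** The summands of [noise_defect] are nonnegative, so each is below [tau ^+ 2]; what remains is the
    deterministic estimate. *)
Lemma overlap_le_of_noise_defect (eps tau g m : R) w :
  0 < eps -> 0 <= g <= 8^-1 -> 0 <= m <= nu -> 0 <= tau <= 8^-1 ->
  8 * tau <= eps -> dotv s s <= (g * m) ^+ 2 -> dotv s' s' <= (g * m) ^+ 2 ->
  noise_defect w < tau ^+ 2 ->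
  `|dotv (lnorm (s + x w)) (lnorm (s' + x' w))| <= eps + 8 * g.
Proof.
move=> e0 g8 mnu t8 te ss ss' hZ.
have nu2 : 0 < nu ^+ 2 by rewrite exprn_gt0.
have [/andP[g0 _] /andP[t0 t81]] := (g8, t8).
apply/lnorm_dotv_le; first by lra.
(* The signals are orthogonal to [ones], so only entry sums of the noise survive in the projection
   corrections. *)
rewrite /norm2 !dotv_Pperp 1?ltnW// !dotvDl !dotvDr (s0 : dotv s _ = 0)
  (s0' : dotv s' _ = 0) !add0r (dotvC (x w) s) (dotvC (x w) s') (dotvC (x' w) s').
rewrite -/(L w) -/(L' w) !addrA.
have -> : dotv s s + dotv s (x w) + dotv s (x w) = dotv s s + 2 * dotv s (x w) by ring.
have -> : dotv s' s' + dotv s' (x' w) + dotv s' (x' w) =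
  dotv s' s' + 2 * dotv s' (x' w) by ring.
have k0 : 0 < (nu ^+ 2) ^+ 2 by rewrite exprn_gt0.
have k1 : 0 < n%:R * nu ^+ 2 by rewrite mulr_gt0.
rewrite /noise_defect !mulrDl in hZ.
have q (z k : R) : 0 < k -> 0 <= z ^+ 2 / k by move=> k00; rewrite divr_ge0 ?sqr_ge0 ?ltW.
have := q (dotv s (x w)) _ k0; have := q (dotv s (x' w)) _ k0.
have := q (dotv s' (x w)) _ k0; have := q (dotv s' (x' w)) _ k0.
have := q (dotv (x w) (x' w)) _ k0.
have := q (dotv (x w) (x w) - nu ^+ 2) _ k0.
have := q (dotv (x' w) (x' w) - nu ^+ 2) _ k0.
have := q (L w) _ k1; have := q (L' w) _ k1.
move=> q1 q2 q3 q4 q5 q6 q7 q8 q9.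
(* The squared entry sums are themselves the required quantities: no root is taken, and
   [tau ^+ 2 <= tau] suffices. *)
have L1 (l : R) : l ^+ 2 / (n%:R * nu ^+ 2) < tau ^+ 2 -> n%:R^-1 * l ^+ 2 <= tau * nu ^+ 2.
  move=> h; have tt : tau ^+ 2 <= tau by rewrite expr2 ler_piMl//; lra.
  rewrite -ler_pdivrMr// (_ : _ / _ = l ^+ 2 / (n%:R * nu ^+ 2)); last first.
    by field; rewrite !lt0r_neq0.
  by rewrite (le_trans (ltW h)).
apply: (normalized_overlap_bound (nu := nu) (tau := tau) (m := m)) => //.
- exact: dotv_ge0.
- exact: dotv_ge0.
- by rewrite (le_trans (normr_dotv_le _ _))//; lra.
- by apply: normr_le_of_sqr_div_lt => //; lra.
- by apply: normr_le_of_sqr_div_lt => //; lra.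
- by apply: normr_le_of_sqr_div_lt => //; lra.
- by apply: normr_le_of_sqr_div_lt => //; lra.
- by apply: normr_le_of_sqr_div_lt => //; lra.
- by apply: normr_le_of_sqr_div_lt => //; lra.
- by apply: normr_le_of_sqr_div_lt => //; lra.
- by apply: L1; lra.
- by apply: L1; lra.
Qed.

(** In the form without denominators the event compares polynomials and square roots of polynomials
    in the noise entries. *)
Lemma measurable_overlap_le (k : R) : 0 <= k ->
  measurable [set w | `|dotv (lnorm (s + x w)) (lnorm (s' + x' w))| <= k].
Proof.
move=> k0.
have mx i : measurable_fun setT (fun w => (s + x w) i 0).
  under eq_fun do rewrite !mxE; apply: measurable_funD => //; by case: (lawxi i).
have mx' i : measurable_fun setT (fun w => (s' + x' w) i 0).
  under eq_fun do rewrite !mxE; apply: measurable_funD => //; by case: (lawxi' i).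
have mdot (y z : T -> 'cV[R]_n) :
    (forall i, measurable_fun setT (fun w => y w i 0)) ->
    (forall i, measurable_fun setT (fun w => z w i 0)) ->
    measurable_fun setT (fun w => dotv (y w) (z w)).
  by move=> my mz; apply: measurable_sum => i; exact: measurable_funM.
have mone i : measurable_fun setT (fun w : T => ones R n i 0).
  exact: measurable_cst.
have mP (y z : T -> 'cV[R]_n) :
    (forall i, measurable_fun setT (fun w => y w i 0)) ->
    (forall i, measurable_fun setT (fun w => z w i 0)) ->
    measurable_fun setT (fun w => dotv (Pperp R n *m y w) (Pperp R n *m z w)).
  move=> my mz; under eq_fun do rewrite dotv_Pperp 1?ltnW//.
  apply: measurable_funB; first exact: mdot.
  apply: measurable_funM; last exact: (mdot z (fun=> ones R n)).
  by apply: measurable_funM => //; exact: (mdot y (fun=> ones R n)).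
have msqrt (f : T -> R) : measurable_fun setT f ->
    measurable_fun setT (fun w => Num.sqrt (f w)).
  move=> mf; apply: (@measurableT_comp _ _ _ _ _ _ (@Num.sqrt R)) => //.
  by apply: continuous_measurable_fun; exact: sqrt_continuous.
rewrite [X in measurable X](_ : _ = setT `&` [set w |
  `|dotv (Pperp R n *m (s + x w)) (Pperp R n *m (s' + x' w))| <=
  k * (norm2 (Pperp R n *m (s + x w)) * norm2 (Pperp R n *m (s' + x' w)))]).
  apply: measurable_fun_le => //.
    by apply: measurableT_comp => //; exact: mP.
  apply: measurable_funM => //.
  by apply: measurable_funM; apply: msqrt; exact: mP.
by rewrite setTI; apply/seteqP; split => w /= /lnorm_dotv_le; exact.
Qed.

(** Markov's inequality for [noise_defect] at level [tau ^+ 2]. *)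
Lemma overlap_probability (eps tau g m : R) :
  0 < eps -> 0 <= g <= 8^-1 -> 0 <= m <= nu -> 0 < tau <= 8^-1 ->
  8 * tau <= eps -> dotv s s <= (g * m) ^+ 2 -> dotv s' s' <= (g * m) ^+ 2 ->
  ((1 - 121 / n%:R / tau ^+ 2)%:E <=
   P [set w | (`|dotv (lnorm (s + x w)) (lnorm (s' + x' w))| <= eps + 8 * g)%R])%E.
Proof.
move=> e0 g8 mnu /andP[t0 t8] te ss ss'.
have [/andP[g0 gle] /andP[m0 mle]] := (g8, mnu).
have gm : (g * m) ^+ 2 <= nu ^+ 2.
  rewrite ler_pXn2r ?nnegrE ?mulr_ge0//; last exact: ltW.
  by rewrite -[leRHS]mul1r; apply: ler_pM => //; lra.
have [k k121 hk] := has_mean_noise_defect (le_trans ss gm) (le_trans ss' gm).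
have tau2 : 0 < tau ^+ 2 by rewrite exprn_gt0.
apply: (@probability_ge_setC _ _ _ _ _ [set w | tau ^+ 2 <= noise_defect w]).
- by apply: measurable_overlap_le; lra.
- rewrite -[X in measurable X]setTI; apply: measurable_fun_le => //.
  exact: has_mean_measurable hk.
- move=> w /= /negP; rewrite -ltNge => hw.
  by apply: (overlap_le_of_noise_defect (tau := tau) (m := m)); rewrite ?(ltW t0).
- apply: (le_trans (has_mean_markov hk _ tau2)).
    move=> w; apply: addr_ge0; apply: divr_ge0;
      rewrite ?addr_ge0 ?sqr_ge0 ?exprn_even_ge0// mulr_ge0 ?sqr_ge0 ?ltW//.
  by rewrite lee_fin ler_wpM2r// invr_ge0 ltW.
Qed.

End overlap.

(** * Choice of the constants and conclusion *)

Theorem theorem1 (R : realType) (eps delta : R) :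
  0 < eps -> 0 < delta < 1 ->
  exists C c : R, 0 < c /\
  forall (n : nat) (M : 'M[R]_n) (nu : R) (x x' : 'cV[R]_n)
         (d : measure_display) (T : measurableType d) (P : probability T R)
         (xi xi' : 'I_n -> T -> R),
    (3 <= n)%N ->
    doubly_stochastic M -> primitive_mx M ->
    0 < nu ->
    in_Vperp x -> in_Vperp x' ->
    (forall i, has_normal_law P (xi i) 0 (nu / Num.sqrt n%:R)) ->
    (forall i, has_normal_law P (xi' i) 0 (nu / Num.sqrt n%:R)) ->
    mutually_independent P (join_fam xi xi') ->
    let s := M *m x in
    let s' := M *m x' in
    let u := fun w => lnorm (s + rvec xi w) in
    let v := fun w => lnorm (s' + rvec xi' w) in
    let gamma := Num.max (norm2 s) (norm2 s') /
                 fine ('E_P[fun w => norm2 (@Pperp R n *m rvec xi w)])%E in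
    gamma <= 8^-1 ->
    ((1 - delta - C * expR (- c * n%:R * eps ^+ 2))%:E <=
       P [set w | (`|dotv (u w) (v w)| <= eps + 8 * gamma)%R])%E.
Proof.
move=> eps0 /andP[delta0 _].
(* The largest value meeting both [tau <= 8^-1] and [8 * tau <= eps]. *)
pose tau := Num.min eps 1 / 8.
have min0 : 0 < Num.min eps 1 by rewrite lt_min eps0 ltr01.
have tau0 : 0 < tau by rewrite divr_gt0.
have tau8 : tau <= 8^-1.
  have : Num.min eps 1 <= 1 by rewrite ge_min lexx orbT.
  by rewrite /tau; lra.
have taueps : 8 * tau <= eps.
  have : Num.min eps 1 <= eps by rewrite ge_min lexx.
  by rewrite /tau; lra.
(* The threshold on n beyond which the Markov bound is at most [delta]; it depends on [eps] and
   [delta] alone. *)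
pose K := 121 / (delta * tau ^+ 2).
exists (expR (K * eps ^+ 2)), 1; split=> // n M nu x x' d T P xi xi' n3 hM _ nu0
  hx hx' lawxi lawxi' indep s s' u v gamma gamma8.
have n1 : (1 < n)%N by exact: leq_trans n3.
have n0 : 0 < n%:R :> R by rewrite ltr0n ltnW.
have inl_inj : injective (@inl 'I_n 'I_n) by move=> i j [].
have lawX k : has_normal_law P (join_fam xi xi' k) 0 (nu / Num.sqrt n%:R).
  by case: k.
have [m /andP[m0 mnu] hm] := has_mean_Pperp_noise n1 nu0 lawX indep inl_inj.
have mE : fine ('E_P[fun w => norm2 (@Pperp R n *m rvec xi w)])%E = m.
  by rewrite unlock; have [_ ->] := hm.
have gammam : gamma * m = Num.max (norm2 s) (norm2 s').
  by rewrite /gamma mE divfK// lt0r_neq0.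
have max0 : 0 <= Num.max (norm2 s) (norm2 s') by rewrite le_max norm2_ge0.
have gamma0 : 0 <= gamma by rewrite -(pmulr_lge0 _ m0) gammam.
have ss : dotv s s <= (gamma * m) ^+ 2.
  by rewrite -norm2_sqr gammam ler_pXn2r ?nnegrE ?norm2_ge0// le_max lexx.
have ss' : dotv s' s' <= (gamma * m) ^+ 2.
  by rewrite -norm2_sqr gammam ler_pXn2r ?nnegrE ?norm2_ge0// le_max lexx orbT.
(* Below the threshold the exponential term is at least 1, so the claimed lower bound is negative;
   above it, that term is dropped. *)
have [nK|Kn] := ltP n%:R K.
  apply: (@le_trans _ _ 0%E); last exact: measure_ge0.
  rewrite lee_fin -expRD.
  have : 1 <= expR (K * eps ^+ 2 + - 1 * n%:R * eps ^+ 2).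
    rewrite -[leLHS]expR0 ler_expR mulN1r mulNr -mulrBl.
    by rewrite mulr_ge0 ?sqr_ge0// subr_ge0 ltW.
  lra.
have Vs := doubly_stochastic_Vperp hM hx.
have Vs' := doubly_stochastic_Vperp hM hx'.
apply: le_trans (overlap_probability n1 nu0 lawxi lawxi' indep Vs Vs'
  (tau := tau) (m := m) eps0 _ _ _ taueps ss ss'); last 3 first.
- by rewrite gamma0 gamma8.
- by rewrite ltW.
- by rewrite tau0 tau8.
rewrite lee_fin.
have : 121 / n%:R / tau ^+ 2 <= delta.
  rewrite ler_pdivrMr ?exprn_gt0// ler_pdivrMr// mulrC.
  by rewrite -ler_pdivrMr// mulr_gt0// exprn_gt0.
have : 0 <= expR (K * eps ^+ 2) * expR (- 1 * n%:R * eps ^+ 2).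
  by rewrite mulr_ge0 ?expR_ge0.
lra.
Qed.
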